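(* Let $\alpha:I\to\mathbb{E}^4_1$ be a null Cartan curve with $\kappa_3=0$ and $\kappa_2=\lambda_0$, where $\lambda_0\in\mathbb{R}$ is constant, and let $V=\lambda_0T+N$. Then for every $(A,\mu)\in\mathbb{R}^2$ the vector $$W_{A,\mu}=A(\lambda_0T+B_1)+\mu B_2$$ is a fixed axis (i.e. it is constant along $\alpha$), with $\langle V,W_{A,\mu}\rangle=\lambda_0\mu$.
   Context: Minkowski space-time $\mathbb{E}^4_1$ is $\mathbb{R}^4$ with the metric $\langle x,y\rangle=-x_1y_1+x_2y_2+x_3y_3+x_4y_4$. A null Cartan curve is a smooth null curve $\alpha:I\to\mathbb{E}^4_1$ ($I$ an interval, $\alpha'\neq0$, $\langle\alpha',\alpha'\rangle=0$) parametrized by pseudo-arc length $s$ (so $\langle\alpha'',\alpha''\rangle=1$), together with its Cartan frame $\{T,N,B_1,B_2\}$, $T=\alpha'$, $N=\alpha''$, where $\langle T,T\rangle=\langle B_2,B_2\rangle=0$, $\langle N,N\rangle=\langle B_1,B_1\rangle=1$, $\langle T,B_2\rangle=1$, all other inner products of frame vectors vanish, $\det(T,N,B_1,B_2)=1$, and $$T'=N,\quad N'=\kappa_2B_1-B_2,\quad B_1'=\kappa_3T-\kappa_2N,\quad B_2'=-\kappa_3B_1$$ for smooth functions $\kappa_2,\kappa_3:I\to\mathbb{R}$ (the Cartan curvatures). Primes denote $d/ds$. *)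

(* Defs.v *)
From mathcomp Require Import all_boot all_order all_algebra.
From mathcomp Require Import all_classical all_reals all_analysis.
Set Implicit Arguments.
Unset Strict Implicit.
Unset Printing Implicit Defensive.
Import Order.TTheory GRing.Theory Num.Theory numFieldNormedType.Exports.
Local Open Scope classical_set_scope.
Local Open Scope ring_scope.

Definition lorentz (R : realType) (x y : 'rV[R]_4) : R :=
  - (x 0 0 * y 0 0) + x 0 1 * y 0 1 + x 0 2%:R * y 0 2%:R + x 0 3%:R * y 0 3%:R.

Definition nondegenerate_interval (R : realType) (I : set R) : Prop :=
  is_interval I /\ exists a b, [/\ I a, I b & a < b].

(* [g] is the derivative of [f] along [I].  Maps are total on [R] but only their
   restrictions to [I] matter: the difference quotient is taken inside [I], so
   this is one-sided at an endpoint of [I] belonging to [I], and it is the usual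
   derivative at interior points (see [derivative_on_interior]). *)
Definition derivative_on (R : realType) (V : normedModType R) (I : set R)
    (f g : R -> V) : Prop :=
  forall t, I t ->
    (s - t)^-1 *: (f s - f t) @[s --> within I t^'] --> g t.

Definition smooth_on (R : realType) (V : normedModType R) (I : set R)
    (f : R -> V) : Prop :=
  exists D : nat -> R -> V,
    (forall t, I t -> D 0%N t = f t) /\
    (forall n, derivative_on I (D n) (D n.+1)).

Lemma derivative_on_interior (R : realType) (V : normedModType R) (I : set R)
    (f g : R -> V) (t : R) :
  derivative_on I f g -> I° t -> is_derive t 1 f (g t).
Proof.
move=> fg It.
have It' : I t by exact: nbhs_singleton.
have lim : (s - t)^-1 *: (f s - f t) @[s --> t^'] --> g t.
  move=> A /(fg t It') fA.
  have Inear : \forall s \near t^', I s by exact: (@nbhs_dnbhs _ t).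
  by apply: filterS2 Inear fA => s Is /(_ Is).
have lim0 : h^-1 *: ((f \o shift t) (h *: 1) - f t) @[h --> 0^'] --> g t.
  move=> A /lim tA.
  have {}tA : \forall s \near t, s != t -> A ((s - t)^-1 *: (f s - f t)) by [].
  rewrite (near_shift 0 t) in tA.
  apply: filterS tA => h /=; rewrite subr0 addrK -[h + t == t]subr_eq0 addrK.
  by rewrite [h *: 1]mulr1.
by apply: DeriveDef; [apply/cvg_ex; exists (g t) | exact: cvg_lim].
Qed.

Definition null_curve (R : realType) (I : set R) (alpha dalpha : R -> 'rV[R]_4)
    : Prop :=
  [/\ nondegenerate_interval I,
      smooth_on I alpha,
      derivative_on I alpha dalpha,
      (forall s, I s -> dalpha s != 0) &
      (forall s, I s -> lorentz (dalpha s) (dalpha s) = 0)].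

Definition pseudo_arc_length (R : realType) (I : set R)
    (ddalpha : R -> 'rV[R]_4) : Prop :=
  forall s, I s -> lorentz (ddalpha s) (ddalpha s) = 1.

Record cartan_basis (R : realType) (t n b1 b2 : 'rV[R]_4) : Prop := {
  cartan_TT : lorentz t t = 0;
  cartan_TN : lorentz t n = 0;
  cartan_TB1 : lorentz t b1 = 0;
  cartan_TB2 : lorentz t b2 = 1;
  cartan_NN : lorentz n n = 1;
  cartan_NB1 : lorentz n b1 = 0;
  cartan_NB2 : lorentz n b2 = 0;
  cartan_B1B1 : lorentz b1 b1 = 1;
  cartan_B1B2 : lorentz b1 b2 = 0;
  cartan_B2B2 : lorentz b2 b2 = 0;
  cartan_det : \det (\matrix_(i < 4) nth 0 [:: t; n; b1; b2] i) = 1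
}.

(* The equations for [alpha] and [T] say that T = alpha' and N = alpha''.
   Smoothness of the frame follows from the Frenet equations. *)
Record null_cartan_curve (R : realType) (I : set R)
    (alpha T N B1 B2 : R -> 'rV[R]_4) (kappa2 kappa3 : R -> R^o) : Prop := {
  cartan_null : null_curve I alpha T;
  cartan_arc : pseudo_arc_length I N;
  cartan_frame : forall s, I s -> cartan_basis (T s) (N s) (B1 s) (B2 s);
  cartan_smooth2 : smooth_on I kappa2;
  cartan_smooth3 : smooth_on I kappa3;
  frenet_T : derivative_on I T N;
  frenet_N : derivative_on I N (fun s => kappa2 s *: B1 s - B2 s);
  frenet_B1 : derivative_on I B1 (fun s => kappa3 s *: T s - kappa2 s *: N s);
  frenet_B2 : derivative_on I B2 (fun s => - kappa3 s *: B1 s)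
}.

Definition fixed_axis (R : realType) (I : set R) (W : R -> 'rV[R]_4) : Prop :=
  exists w, forall s, I s -> W s = w.

(* Main.v *)
Require Import Defs.
From mathcomp Require Import all_boot all_order all_algebra.
From mathcomp Require Import all_classical all_reals all_analysis.
From mathcomp Require Import ring.
Import Order.TTheory GRing.Theory Num.Theory numFieldNormedType.Exports.
Local Open Scope classical_set_scope.
Local Open Scope ring_scope.

(** The Frenet equations with [kappa3 = 0] and [kappa2 = lambda0] read
    [T' = N], [B1' = - lambda0 N] and [B2' = 0]. Hence [lambda0 T + B1] and [B2]
    both have zero derivative, and so does every linear combination [W] of them.
    A curve with zero derivative along an interval is constant
    ([derivative_on0_cst]): each coordinate is continuous on the interval and
    differentiable inside it, so the mean value theorem applies. The only care
    needed is at the endpoints of the interval, where the derivative is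
    one-sided and gives continuity only from within ([derivative_on_cvg]).

    The inner product follows by expanding [<lambda0 T + N, W>] bilinearly: of
    the pairings of [T] and [N] with [T], [B1] and [B2], only [<T, B2> = 1] is
    nonzero. *)

Section DerivativeOn.
Set Implicit Arguments.
Unset Strict Implicit.
Variables (R : realType) (I : set R).

Lemma derivative_onD (V : normedModType R) (f g df dg : R -> V) :
  derivative_on I f df -> derivative_on I g dg ->
  derivative_on I (fun s => f s + g s) (fun s => df s + dg s).
Proof.
move=> f' g' t It; apply: cvg_trans (cvgD (f' t It) (g' t It)).
by apply: near_eq_cvg; near=> s; rewrite fctE -scalerDr opprD addrACA.
Unshelve. all: by end_near. Qed.

Lemma derivative_onZ (V : normedModType R) (c : R) (f df : R -> V) :
  derivative_on I f df ->
  derivative_on I (fun s => c *: f s) (fun s => c *: df s).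
Proof.
move=> f' t It; apply: cvg_trans (cvgZ (cvg_cst c) (f' t It)).
by apply: near_eq_cvg; near=> s; rewrite -scalerBr !scalerA mulrC.
Unshelve. all: by end_near. Qed.

Lemma eq_derivative_on (V : normedModType R) (f dg df : R -> V) :
  (forall t, I t -> df t = dg t) ->
  derivative_on I f df -> derivative_on I f dg.
Proof. by move=> eq_d f' t It; rewrite -eq_d //; exact: f'. Qed.

Lemma derivative_on_coord m n (f df : R -> 'M[R]_(m, n)) i j :
  derivative_on I f df ->
  derivative_on I (fun s => f s i j : R^o) (fun s => df s i j : R^o).
Proof.
move=> f' t It.
have cvg_coord : ((s - t)^-1 *: (f s - f t)) i j @[s --> within I t^'] -->
    (df t i j : R^o).
  exact: continuous_cvg (@coord_continuous R m n i j (df t)) (f' t It).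
by apply: cvg_trans cvg_coord; apply: near_eq_cvg; near=> s; rewrite !mxE.
Unshelve. all: by end_near. Qed.

(** Away from [t], [f s - f t] is [s - t] times a difference quotient that has a
    limit, hence it tends to [0]. *)
Lemma derivative_on_cvg (V : normedModType R) (f df : R -> V) (t : R) :
  derivative_on I f df -> I t -> f s @[s --> within I (nbhs t)] --> f t.
Proof.
move=> f' It.
have s_t : s @[s --> within I t^'] --> t.
  by do 2 apply: cvg_within_filter; exact: cvg_id.
have st0 : (s - t) @[s --> within I t^'] --> (0 : R).
  by rewrite -(subrr t); apply: cvgB s_t _; exact: cvg_cst.
have neq_t : \forall s \near within I t^', s != t.
  by rewrite near_withinE; apply: filterS (nbhs_dnbhs_neq t).
have lim : f s @[s --> within I t^'] --> f t.
  have lim : (s - t) *: ((s - t)^-1 *: (f s - f t)) + f t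
      @[s --> within I t^'] --> f t.
    rewrite -[X in _ --> X]add0r -(scale0r (df t)).
    by apply: cvgD; [exact: cvgZ st0 (f' t It) | exact: cvg_cst].
  apply: cvg_trans lim; apply: near_eq_cvg.
  near=> s; rewrite scalerA divff ?scale1r ?subrK // subr_eq0.
  by near: s.
move=> A At; have : \forall s \near t, s != t -> I s -> A (f s) by exact: lim.
apply: (@filterS _ (nbhs t)) => s As Is /=.
by have [->|s_neq_t] := eqVneq s t; [exact: nbhs_singleton | exact: As].
Unshelve. all: by end_near. Qed.

(** The usual mean value theorem asks for two-sided derivatives only inside
    [`]a, b[], where the derivative along [I] is one; at [a] and [b] the
    derivative may be one-sided, but continuity from within suffices there. *)
Lemma derivative_on_MVT (f df : R -> R^o) (a b : R) :
  is_interval I -> derivative_on I f df -> I a -> I b -> a < b ->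
  exists2 c, c \in `]a, b[ & f b - f a = df c * (b - a).
Proof.
move=> itvI f' Ia Ib ab.
have sub : `[a, b]%classic `<=` I by move=> x /=; rewrite in_itv /=; exact: itvI.
apply: MVT => // [x xab|].
  apply: derivative_on_interior f' _; have near_ab := near_in_itvoo xab.
  by apply: filterS near_ab => y yab; apply/sub/subset_itv_oo_cc.
apply/subspace_continuousP => x xab.
move=> A Afx; have : \forall s \near x, I s -> A (f s).
  exact: (derivative_on_cvg f' (sub _ xab)).
by apply: (@filterS _ (nbhs x)) => s As /sub.
Qed.

Lemma derivative_on0_cst m n (f : R -> 'M[R]_(m, n)) :
  is_interval I -> derivative_on I f (fun=> 0) ->
  forall s t, I s -> I t -> f s = f t.
Proof.
move=> itvI f'.
have lt_cst s t : I s -> I t -> s < t -> f s = f t.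
  move=> Is It st; apply/matrixP => i j.
  have fij' := derivative_on_coord (i := i) (j := j) f'.
  have [c _] := derivative_on_MVT itvI fij' Is It st.
  by rewrite mxE mul0r => /eqP; rewrite subr_eq0 => /eqP.
move=> s t Is It; have [st|ts|->//] := ltgtP s t; first exact: lt_cst.
by rewrite (lt_cst t s).
Qed.

End DerivativeOn.

Lemma lorentzC (R : realType) (x y : 'rV[R]_4) : lorentz x y = lorentz y x.
Proof. by rewrite /lorentz; ring. Qed.

Lemma lorentzDl (R : realType) (x y z : 'rV[R]_4) :
  lorentz (x + y) z = lorentz x z + lorentz y z.
Proof. by rewrite /lorentz !mxE; ring. Qed.

Lemma lorentzZl (R : realType) (c : R) (x y : 'rV[R]_4) :
  lorentz (c *: x) y = c * lorentz x y.
Proof. by rewrite /lorentz !mxE; ring. Qed.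

Lemma lorentzDr (R : realType) (x y z : 'rV[R]_4) :
  lorentz z (x + y) = lorentz z x + lorentz z y.
Proof. by rewrite !(lorentzC z) lorentzDl. Qed.

Lemma lorentzZr (R : realType) (c : R) (x y : 'rV[R]_4) :
  lorentz y (c *: x) = c * lorentz y x.
Proof. by rewrite !(lorentzC y) lorentzZl. Qed.

Theorem theorem7 (R : realType) (I : set R)
    (alpha T N B1 B2 : R -> 'rV[R]_4) (kappa2 kappa3 : R -> R) (lambda0 : R)
    (halpha : null_cartan_curve I alpha T N B1 B2 kappa2 kappa3)
    (hkappa3 : forall s, I s -> kappa3 s = 0)
    (hkappa2 : forall s, I s -> kappa2 s = lambda0) :
  let V : R -> 'rV[R]_4 := fun s => lambda0 *: T s + N s in
  forall A mu : R,
    let W : R -> 'rV[R]_4 := fun s => A *: (lambda0 *: T s + B1 s) + mu *: B2 s in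
    fixed_axis I W /\
    (forall s, I s -> lorentz (V s) (W s) = lambda0 * mu).
Proof.
move=> V A mu W.
have [[[itvI [a [_ [Ia _ _]]]] _ _ _ _] _ frame _ _ T' _ B1' B2'] := halpha.
split; last first.
  move=> s /frame [TT TN TB1 TB2 _ NB1 NB2 _ _ _ _].
  rewrite /V /W !(lorentzDl, lorentzDr, lorentzZl, lorentzZr) (lorentzC (N s) (T s)).
  by rewrite TT TN TB1 TB2 NB1 NB2; ring.
exists (W a) => s Is; apply: (derivative_on0_cst (I := I)) => //.
have W' := derivative_onD
  (derivative_onZ (c := A)
    (derivative_onD (derivative_onZ (c := lambda0) T') B1'))
  (derivative_onZ (c := mu) B2').
apply: eq_derivative_on W' => t It.
by rewrite hkappa2 // hkappa3 // scale0r sub0r subrr oppr0 scale0r !scaler0 addr0.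
Qed.
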